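(* Let $X,Y$ be arbitrary algebraic subsets of $\mathbb{P}^n$ (the $n$-dimensional projective space over $\mathbb{C}$). Then $$\mathcal{J}(X,Y)=\mathcal{J}^0(X,Y)\cup\bigcup_{P\in X\cap Y}\mathcal{C}_P(X,Y),$$ $$J(X,Y)=J^0(X,Y)\cup\bigcup_{P\in X\cap Y}C_P(X,Y).$$
   Context: $G(1,\mathbb{P}^n)$ is the Grassmannian of projective lines in $\mathbb{P}^n=\mathbb{P}^n(\mathbb{C})$; $[L]$ is the point of $G(1,\mathbb{P}^n)$ corresponding to a projective line $L$; $\overline{PQ}$ is the line spanned by $P\ne Q$. Put $\mathcal{J}^0(X,Y):=\{[\overline{PQ}]\in G(1,\mathbb{P}^n):P\in X,\ Q\in Y,\ P\ne Q\}$, $\mathcal{J}(X,Y):=\overline{\mathcal{J}^0(X,Y)}$ (closure in $G(1,\mathbb{P}^n)$), $J^0(X,Y):=\bigcup_{[L]\in\mathcal{J}^0(X,Y)}L$, $J(X,Y):=\bigcup_{[L]\in\mathcal{J}(X,Y)}L$. For analytic subsets $X,Y$ of a neighbourhood of $\mathbf 0\in\mathbb{C}^n$ with $\mathbf 0\in X\cap Y$, the relative tangent cone $C_0(X,Y)$ is the set of $\mathbf v\in\mathbb{C}^n$ for which there exist sequences $\mathbf x_\nu\in X$, $\mathbf y_\nu\in Y$, $\lambda_\nu\in\mathbb{C}$ with $\mathbf x_\nu\to\mathbf 0$, $\mathbf y_\nu\to\mathbf 0$, $\lambda_\nu(\mathbf y_\nu-\mathbf x_\nu)\to\mathbf v$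 as $\nu\to\infty$. For analytic subsets $X,Y$ of a neighbourhood of a point $P\in\mathbb{C}^n$ with $P\in X\cap Y$, put $C_P(X,Y):=P+C_0(X-P,Y-P)$. For algebraic subsets $X,Y$ of $\mathbb{P}^n$ and $P\in X\cap Y$, let $U\ni P$ be a canonical affine part of $\mathbb{P}^n$ (complement of a coordinate hyperplane) with corresponding canonical map $\varphi:U\to\mathbb{C}^n$, and put $C_P(X,Y):=\overline{\varphi^{-1}(C_{\varphi(P)}(\varphi(X\cap U),\varphi(Y\cap U)))}$ (closure in $\mathbb{P}^n$), which does not depend on the choice of $U$. Finally $\mathcal{C}_P(X,Y):=\{[L]\in G(1,\mathbb{P}^n):L\subset C_P(X,Y)\text{ and }P\in L\}$.
   Formalization: The second equality is stated only when X and Y are not both equal to the same single point {P}; in that case it fails, since J(X,Y) is empty while C_P(X,Y) = {P}. *)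

(* Defs.v *)
From HB Require Import structures.
From mathcomp Require Import all_boot all_order all_algebra.
From mathcomp Require Import complex.
From mathcomp Require mpoly.
Import (canonicals, coercions) mpoly.
From mathcomp Require Import all_classical all_reals topology normedtype.
Import Order.TTheory GRing.Theory Num.Theory.
Import numFieldNormedType.Exports.

Set Implicit Arguments.
Unset Strict Implicit.
Unset Printing Implicit Defensive.

Local Open Scope classical_set_scope.
Local Open Scope ring_scope.

(* Everything is defined over a numFieldType K, with the topology given by its
   norm, and is used at K = R[i] for R : realType, i.e. over the complex numbers
   with their usual topology.  (No topological structure is declared on R[i]
   itself; the one on K is inherited from numFieldType.) *)

Record grass (K : numFieldType) (k m : nat) := Grass {
  gr_space :> {vspace 'rV[K]_m};
  gr_dim : \dim gr_space == k }.

HB.instance Definition _ (K : numFieldType) k m :=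
  [isSub for @gr_space K k m].
HB.instance Definition _ (K : numFieldType) k m :=
  [Choice of grass K k m by <:].

Definition frames (K : numFieldType) (k m : nat) : set 'M[K]_(k, m) :=
  [set A | row_free A].
Arguments frames : clear implicits.

Definition row_span (K : numFieldType) (k m : nat) (A : 'M[K]_(k, m)) :
    {vspace 'rV[K]_m} :=
  <<[tuple row i A | i < k]>>%VS.

Lemma dim_row_span (K : numFieldType) (k m : nat) (A : frames K k m) :
  \dim (row_span (set_val A)) == k.
Proof.
have: row_free (set_val A) by exact: (set_valP A).
move: (set_val A) => B Bfree.
suff : free [tuple row i B | i < k].
  by rewrite /free size_tuple.
apply/freeP => c c0 i.
have : (\row_j c j) *m B = 0 *m B.
  rewrite mul0mx mulmx_sum_row -[RHS]c0; apply: eq_bigr => j _.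
  by rewrite mxE nth_mktuple.
by move/(row_free_inj Bfree)/rowP/(_ i); rewrite !mxE.
Qed.

Definition gr_span (K : numFieldType) (k m : nat) (A : frames K k m) :
    grass K k m := Grass (dim_row_span A).

(* The topology of the Grassmannian is the quotient topology along gr_span,
   the set of full-rank matrices being a subspace of 'M[K]_(k, m). *)
Section GrassTopology.
Variables (K : numFieldType) (k m : nat).

Let gr_open : set_system (grass K k m) :=
  [set U | open (@gr_span K k m @^-1` U)].

Let gr_openT : gr_open setT.
Proof. by rewrite /gr_open /= preimage_setT; exact: openT. Qed.

Let gr_openI : setI_closed gr_open.
Proof. by move=> A B oA oB; rewrite /gr_open /= preimage_setI; exact: openI. Qed.

Let gr_open_bigU (I : Type) (f : I -> set (grass K k m)) :
  (forall i, gr_open (f i)) -> gr_open (\bigcup_i f i).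
Proof.
move=> of_; rewrite /gr_open /= preimage_bigcup.
by apply: bigcup_open => i _; exact: of_.
Qed.

HB.instance Definition _ :=
  @isOpenTopological.Build (grass K k m) gr_open gr_openT gr_openI gr_open_bigU.

End GrassTopology.

Notation proj_space K n := (grass K 1 n.+1).
Notation proj_lines K n := (grass K 2 n.+1).

Section Joins.
Variables (K : numFieldType) (n : nat).
Implicit Types (P Q : proj_space K n) (L : proj_lines K n).
Implicit Types X Y : set (proj_space K n).

(* S may be infinite and the degree may vary with f. *)
Definition algebraic_set X :=
  exists S : set (mpoly.mpoly n.+1 K),
    (forall f, S f -> exists d, f \is mpoly.ishomog1 d mpoly.mdeg) /\
    X = [set P | forall f (v : 'rV[K]_n.+1), S f -> v \in gr_space P ->
                   mpoly.meval (fun i => v 0 i) f = 0].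

Definition points_of L : set (proj_space K n) :=
  [set P | (gr_space P <= gr_space L)%VS].

Definition joining_lines0 X Y : set (proj_lines K n) :=
  [set L | exists P Q,
     [/\ X P, Y Q, P <> Q & gr_space L = (gr_space P + gr_space Q)%VS]].

Definition joining_lines X Y : set (proj_lines K n) :=
  closure (joining_lines0 X Y).

Definition join0 X Y : set (proj_space K n) :=
  \bigcup_(L in joining_lines0 X Y) points_of L.

Definition join X Y : set (proj_space K n) :=
  \bigcup_(L in joining_lines X Y) points_of L.

End Joins.

Section RelativeTangentCone.
Variables (K : numFieldType) (n : nat).
Implicit Types (X Y : set 'rV[K]_n) (p : 'rV[K]_n).

Definition rel_tangent_cone0 X Y : set 'rV[K]_n :=
  [set v | exists (x y : nat -> 'rV[K]_n) (lambda : nat -> K),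
     [/\ forall k, X (x k), forall k, Y (y k),
         x @ \oo --> (0 : 'rV[K]_n), y @ \oo --> (0 : 'rV[K]_n) &
         (fun k => lambda k *: (y k - x k)) @ \oo --> v]].

Definition rel_tangent_cone p X Y : set 'rV[K]_n :=
  [set p + v | v in rel_tangent_cone0 [set x - p | x in X]
                                      [set y - p | y in Y]].

End RelativeTangentCone.

Section ProjectiveRelativeTangentCone.
Variables (K : numFieldType) (n : nat).
Implicit Types (P : proj_space K n) (L : proj_lines K n).
Implicit Types X Y : set (proj_space K n).

Definition coord_hyperplane (i : 'I_n.+1) : set (proj_space K n) :=
  [set P | forall v : 'rV[K]_n.+1, v \in gr_space P -> v 0 i = 0].

Definition affine_part (i : 'I_n.+1) : set (proj_space K n) :=
  ~` coord_hyperplane i.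

(* [x_0 : ... : x_n] |-> (x_j / x_i)_(j != i); vpick P is a nonzero vector of
   the line P, and on affine_part i the quotients do not depend on it. *)
Definition affine_map (i : 'I_n.+1) P : 'rV[K]_n :=
  \row_(j < n) (vpick (gr_space P) 0 (lift i j) / vpick (gr_space P) 0 i).

Definition proj_rel_tangent_cone (i : 'I_n.+1) P X Y : set (proj_space K n) :=
  closure (affine_part i `&` affine_map i @^-1`
    rel_tangent_cone (affine_map i P) (affine_map i @` (X `&` affine_part i))
                                      (affine_map i @` (Y `&` affine_part i))).

Definition tangent_lines (i : 'I_n.+1) P X Y : set (proj_lines K n) :=
  [set L | points_of L `<=` proj_rel_tangent_cone i P X Y /\ points_of L P].

End ProjectiveRelativeTangentCone.

(* Main.v *)
Require Import Defs.
From mathcomp Require Import all_boot all_order all_algebra.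
From mathcomp Require Import complex.
From mathcomp Require mpoly.
From mathcomp Require Import all_classical all_reals topology normedtype.
From mathcomp Require Import interval_inference.

Import Order.TTheory GRing.Theory Num.Theory.
Import numFieldNormedType.Exports.

Set Implicit Arguments.
Unset Strict Implicit.
Unset Printing Implicit Defensive.

Local Open Scope classical_set_scope.
Local Open Scope ring_scope.

(** The argument takes limits of secants.  These limits exist because
projective space is compact ([ultra_cvg_point]), and limits of points of [X] or
[Y] stay there because algebraic sets are closed ([algebraic_set_closed]).

The topology of a Grassmannian is handled through frames.  Since GL_k acts on
frames by homeomorphisms, the quotient map is open, so a subspace [L] with a
frame [A] lies in the closure of a set [S] exactly when some frames [B k]
converging to [A] span members of [S] ([closure_grass_seq] and
[closure_grass_cvg]).  Incidence passes to such limits ([row_span_cvg]).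

Limits of secants are secants or tangents ([joining_lines_sub]).  Let [L] be
the limit of lines joining points [P k] of [X] to points [Q k] of [Y].  By
compactness one may assume that [P k] and [Q k] converge, to [P0] in [X] and
[Q0] in [Y], both on [L].  If they differ, [L] joins them.  If [P0 = Q0],
normalise the representatives [x k] of [P k] and [y k] of [Q k] by the
coordinate of the chart; then [x k] and [y k] have the same limit [p], and the
unit vectors [(y k - x k) / |y k - x k|] converge to some nonzero [v].  The line
[L] is spanned by [p] and [v], and rescaling the multipliers shows that
every [p + t v] is in the relative tangent cone ([secant_limit_cone]).

Conversely let [Q] differ from [P] and lie in the relative tangent cone at [P];
then the line [PQ] is a limit of secants ([cone_line]).  When [Q = p + v] is in
the affine cone, with [v] the limit of [l k (y k - x k)], the secant through
[x k] and [y k] also contains [x k + l k (y k - x k)], and these two of its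
points tend to [P] and [Q].  Points at infinity of the cone are reached by
taking the closure once more.

The identity for points follows from the one for lines: a point [Q] of the cone
other than [P] is on the line [PQ] just found.  For [Q = P] any line joining
[P] to a further point of [X] or [Y] will do, and one exists unless [X] and [Y]
are both the single point [P].

Compactness is used through an ultrafilter on the indices, finer than the
filter of neighbourhoods of infinity: every sequence in a compact set converges
along it, so that it replaces the successive extraction of subsequences. *)

(** * Limits of matrices *)

Section MatrixLimits.
Variables (K : numFieldType) (T : Type) (F : set_system T).
Hypothesis FF : Filter F.

Lemma cvg_mxP m n (M : T -> 'M[K]_(m, n)) (N : 'M[K]_(m, n)) :
  M @ F --> N <-> forall i j, (fun t => M t i j) @ F --> N i j.
Proof.
split=> [MN i j|MN].
  apply: (@cvg_comp _ _ _ M (fun L : 'M[K]_(m, n) => L i j) _ _ _ MN).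
  exact: coord_continuous.
apply/cvg_ballP => e e0.
have near_entry i : \forall t \near F, forall j, ball (N i j) e (M t i j).
  by apply: filter_forall => j; move/cvg_ballP: (MN i j); exact.
by apply: filterS (filter_forall FF near_entry) => t tb; split.
Qed.

Lemma cvg_sumr (I : Type) (r : seq I) (P : pred I) (f : I -> T -> K)
    (a : I -> K) :
  (forall i, P i -> f i @ F --> a i) ->
  (fun t => \sum_(i <- r | P i) f i t) @ F --> \sum_(i <- r | P i) a i.
Proof. by move=> fa; apply: cvg_big => //; exact: add_continuous. Qed.

Lemma cvg_prodr (I : Type) (r : seq I) (P : pred I) (f : I -> T -> K)
    (a : I -> K) :
  (forall i, P i -> f i @ F --> a i) ->
  (fun t => \prod_(i <- r | P i) f i t) @ F --> \prod_(i <- r | P i) a i.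
Proof. by move=> fa; apply: cvg_big => //; exact: mul_continuous. Qed.

Lemma cvg_mulmx m n p (A : T -> 'M[K]_(m, n)) (B : T -> 'M[K]_(n, p))
    (A0 : 'M[K]_(m, n)) (B0 : 'M[K]_(n, p)) :
  A @ F --> A0 -> B @ F --> B0 -> (fun t => A t *m B t) @ F --> A0 *m B0.
Proof.
move=> /cvg_mxP cA /cvg_mxP cB; apply/cvg_mxP => i j.
rewrite mxE; under eq_fun do rewrite mxE.
by apply: cvg_sumr => k _; apply: cvgM.
Qed.

Lemma cvg_det n (A : T -> 'M[K]_n) (A0 : 'M[K]_n) :
  A @ F --> A0 -> (fun t => \det (A t)) @ F --> \det A0.
Proof.
move=> /cvg_mxP cA; apply: cvg_sumr => s _.
by apply: cvgM; [exact: cvg_cst|apply: cvg_prodr].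
Qed.

Lemma cvg_adj n (A : T -> 'M[K]_n) (A0 : 'M[K]_n) :
  A @ F --> A0 -> (fun t => \adj (A t)) @ F --> \adj A0.
Proof.
move=> /cvg_mxP cA; apply/cvg_mxP => i j.
rewrite mxE; under eq_fun do rewrite mxE.
apply: cvgM; first exact: cvg_cst.
apply: cvg_det; apply/cvg_mxP => k l; rewrite !mxE.
by under eq_fun do rewrite !mxE; exact: cA.
Qed.

Lemma cvg_col_mx m1 m2 n (A : T -> 'M[K]_(m1, n)) (B : T -> 'M[K]_(m2, n))
    (A0 : 'M[K]_(m1, n)) (B0 : 'M[K]_(m2, n)) :
  A @ F --> A0 -> B @ F --> B0 ->
  (fun t => col_mx (A t) (B t)) @ F --> col_mx A0 B0.
Proof.
move=> /cvg_mxP cA /cvg_mxP cB; apply/cvg_mxP => i j; rewrite mxE.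
by under eq_fun do rewrite mxE; case: fintype.split => k; [exact: cA|exact: cB].
Qed.

Lemma cvg_col' m n i (A : T -> 'M[K]_(m, n)) (A0 : 'M[K]_(m, n)) :
  A @ F --> A0 -> (fun t => col' i (A t)) @ F --> col' i A0.
Proof.
move=> /cvg_mxP cA; apply/cvg_mxP => k l; rewrite mxE.
by under eq_fun do rewrite mxE; exact: cA.
Qed.

End MatrixLimits.

(** * Row spans *)

Section RowSpan.
Variables (K : numFieldType) (m : nat).

Lemma memv_row_span k (A : 'M[K]_(k, m)) (v : 'rV[K]_m) :
  v \in row_span A <-> exists c : 'rV[K]_k, v = c *m A.
Proof.
split=> [/coord_span vE|[c ->]].
  exists (\row_i coord [tuple row i A | i < k] i v).
  rewrite mulmx_sum_row {1}vE; apply: eq_bigr => i _.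
  by rewrite mxE (nth_map i) ?size_enum_ord// nth_ord_enum.
rewrite mulmx_sum_row; apply: memv_suml => i _; apply/memvZ/memv_span.
by apply/mapP; exists i; rewrite ?mem_enum.
Qed.

Lemma row_free_dim_row_span k (A : 'M[K]_(k, m)) :
  (\dim (row_span A) == k) = row_free A.
Proof.
apply/idP/idP => [dimA|Afree]; last first.
  exact: (dim_row_span (exist _ A (mem_set Afree))).
have /freeP Afree : free [tuple row i A | i < k] by rewrite /free size_tuple.
apply: inj_row_free => c cA0; apply/rowP => i; rewrite mxE.
apply: Afree; rewrite -[RHS]cA0 mulmx_sum_row; apply: eq_bigr => j _.
by rewrite (nth_map j) ?size_enum_ord// nth_ord_enum.
Qed.

Lemma row_span_unit_mul k (g : 'M[K]_k) (A : 'M[K]_(k, m)) :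
  g \in unitmx -> row_span (g *m A) = row_span A.
Proof.
move=> gu; apply/vspaceP => v; apply/idP/idP => /memv_row_span[c ->].
  by apply/memv_row_span; exists (c *m g); rewrite mulmxA.
by apply/memv_row_span; exists (c *m invmx g); rewrite mulmxA mulmxKV.
Qed.

Lemma row_span_sum k (A : 'M[K]_(k, m)) :
  row_span A = (\sum_(i < k) <[row i A]>)%VS.
Proof. by rewrite /row_span span_def big_map big_enum. Qed.

Lemma row_span1 (u : 'rV[K]_m) : row_span u = <[u]>%VS.
Proof. by rewrite row_span_sum big_ord1 row_id. Qed.

Lemma row_span2 (u v : 'rV[K]_m) :
  row_span (col_mx u v) = (<[u]> + <[v]>)%VS.
Proof.
by rewrite row_span_sum big_split_ord !big_ord1 rowKu rowKd !row_id.
Qed.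

Lemma row_span_surj k (V : {vspace 'rV[K]_m}) :
  \dim V == k -> exists A : 'M[K]_(k, m), row_span A = V.
Proof.
move=> /eqP <-; exists (\matrix_i (vbasis V)`_i).
rewrite -[RHS](span_basis (vbasisP V)) span_def row_span_sum.
rewrite (big_nth 0) big_mkord size_tuple.
by apply: eq_bigr => i _; rewrite rowK.
Qed.

Lemma row_span_eq k (A B : 'M[K]_(k, m)) :
  row_free B -> row_span A = row_span B ->
  exists2 g : 'M[K]_k, g \in unitmx & B = g *m A.
Proof.
move=> Bfree AB; pose g := B *m pinvmx A.
have BE : B = g *m A.
  apply/row_matrixP => i; rewrite -mulmxA row_mul.
  have /memv_row_span[c cE] : row i B \in row_span A.
    by rewrite AB; apply/memv_row_span; exists (delta_mx 0 i); rewrite rowE.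
  by rewrite mulmxA mulmxKpV// cE submxMl.
exists g => //; rewrite -row_free_unit; apply: inj_row_free => c cg0.
by apply: (row_free_inj Bfree); rewrite /= {1}BE mulmxA cg0 !mul0mx.
Qed.

End RowSpan.

Section RowSpanLimits.
Variables (K : numFieldType) (m : nat) (T : Type) (F : set_system T).
Hypothesis FF : ProperFilter F.

Lemma near_cst_cvg (V : pseudoMetricNormedZmodType K) (f : T -> V) (a b : V) :
  (\forall t \near F, f t = a) -> f @ F --> b -> b = a.
Proof.
move=> fa fb; apply: (@closed_cvg _ _ F FF f (fun x => x = a)) => //.
apply: accessible_closed_set1; apply: hausdorff_accessible.
exact: norm_hausdorff.
Qed.

Section Frame.
Variables (k : nat) (B : T -> 'M[K]_(k, m)) (A : 'M[K]_(k, m)).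
Hypotheses (Afree : row_free A) (BA : B @ F --> A).

Let cvg_right_inverse : (fun t => B t *m pinvmx A) @ F --> (1%:M : 'M[K]_k).
Proof.
by rewrite -(mulmxVp Afree); apply: cvg_mulmx => //; exact: cvg_cst.
Qed.

(** Frames form an open set: the product of [B t] with a right inverse of [A]
    tends to the identity, so its determinant is eventually nonzero. *)
Lemma near_row_free : \forall t \near F, row_free (B t).
Proof.
have /(cvgr_neq0 _) := cvg_det FF cvg_right_inverse.
rewrite det1 => /(_ (oner_neq0 _)); apply: filterS => t.
rewrite -unitfE -unitmxE => BZu.
apply: inj_row_free => c cB0.
by rewrite -[c](mulmxK BZu) mulmxA cB0 !mul0mx.
Qed.

(** Near [A], the coefficients of [u t] on the rows of [B t] are given by
    Cramer's rule for the square matrix [B t *m pinvmx A], which tends to the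
    identity.  Clearing the denominator gives a polynomial identity, which
    passes to the limit. *)
Lemma row_span_cvg (u : T -> 'rV[K]_m) (v : 'rV[K]_m) :
  (\forall t \near F, u t \in row_span (B t)) -> u @ F --> v ->
  v \in row_span A.
Proof.
move=> uB uv; apply/memv_row_span; exists (v *m pinvmx A).
pose f t := \det (B t *m pinvmx A) *: u t
            - u t *m pinvmx A *m \adj (B t *m pinvmx A) *m B t.
have f0 : \forall t \near F, f t = 0.
  apply: filterS uB => t /memv_row_span[c uE].
  rewrite /f uE -[c *m B t *m pinvmx A]mulmxA -[c *m _ *m _]mulmxA mul_mx_adj.
  by rewrite mul_mx_scalar scalemxAl subrr.
apply/eqP; rewrite -subr_eq0; apply/eqP/(near_cst_cvg f0).
have -> : v - v *m pinvmx A *m A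
    = \det (1%:M : 'M[K]_k) *: v - v *m pinvmx A *m \adj 1%:M *m A.
  by rewrite det1 scale1r adj1 mulmx1.
apply: cvgB; first by apply: cvgZ => //; exact: cvg_det.
apply: cvg_mulmx => //; apply: cvg_mulmx; last exact: cvg_adj.
by apply: cvg_mulmx => //; exact: cvg_cst.
Qed.

End Frame.
End RowSpanLimits.

(** * Closures in a Grassmannian *)

Section GrassClosure.
Variables (K : numFieldType) (k m : nat).

(** The quotient map from frames to the Grassmannian is open: two frames of the
    same subspace differ by an invertible [g], and left multiplication by [g]
    is continuous. *)
Lemma open_frame_image (W : set 'M[K]_(k, m)) : open W ->
  open [set L : grass K k m | exists2 B, W B & gr_space L = row_span B].
Proof.
move=> Wo; set U := [set L | _].
suff : open (@gr_span K k m @^-1` U) by [].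
rewrite openE => C [B WB /= CB].
have Bfree : row_free B by rewrite -row_free_dim_row_span -CB dim_row_span.
have [g gu BE] := row_span_eq Bfree CB.
have gW : nbhs (set_val C) [set C' | W (g *m C')].
  have gB : (fun C' => g *m C') @ nbhs (set_val C) --> B.
    by rewrite BE; apply: cvg_mulmx => //; exact: cvg_cst.
  by apply: gB; exact: open_nbhs_nbhs.
have nbhsC : nbhs C (fun C' : frames K k m => W (g *m set_val C')).
  exact: (@initial_continuous _ _ (@set_val _ (frames K k m)) C _ gW).
rewrite /interior /=; apply: filterS nbhsC => C' WgC'; exists (g *m set_val C') => //.
by rewrite /= row_span_unit_mul.
Qed.

Lemma closure_grass_cvg (T : Type) (F : set_system T) (S : set (grass K k m))
    (L : grass K k m) (B : T -> 'M[K]_(k, m)) (A : 'M[K]_(k, m)) :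
  ProperFilter F -> row_span A = gr_space L -> B @ F --> A ->
  (\forall t \near F, exists2 M, S M & gr_space M = row_span (B t)) ->
  closure S L.
Proof.
move=> FF AL BA SB V; rewrite nbhsE => -[U [Uo UL UV]].
have Afree : row_free A by rewrite -row_free_dim_row_span AL; exact: gr_dim.
have {}Uo : open (@gr_span K k m @^-1` U) by exact: Uo.
have [W Wo WE] := Uo.
have frameE (M : grass K k m) (C : 'M[K]_(k, m)) (CM : row_span C = gr_space M)
    : exists2 C' : frames K k m, set_val C' = C & gr_span C' = M.
  have Cfree : row_free C by rewrite -row_free_dim_row_span CM; exact: gr_dim.
  exists (exist _ C (mem_set Cfree)) => //; exact: val_inj.
have WA : W A.
  have [A' <- A'L] := frameE _ _ AL.
  by rewrite -[W _]/((set_val @^-1` W) A') WE /= A'L.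
have WB : \forall t \near F, W (B t) by apply: BA; exact: open_nbhs_nbhs.
have [t [[M SM MB] WBt]] := filter_ex (filterI SB WB).
exists M; split=> //; apply: UV.
have [C CB <-] := frameE _ _ (esym MB).
by rewrite -[U _]/((gr_span (m:=m) @^-1` U) C) -WE /= CB.
Qed.

End GrassClosure.

(** * Sequences *)

Section Sequences.
Variables (K : numFieldType) (eps : nat -> K).
Hypotheses (eps_gt0 : forall i, 0 < eps i) (eps_cvg : eps @ \oo --> (0 : K)).

Lemma cvg_ball_eps (V : pseudoMetricType K) (x : nat -> V) (a : V) :
  (forall i, ball a (eps i) (x i)) -> x @ \oo --> a.
Proof.
move=> xa; apply/cvg_ballP => e e0.
move/cvgrPdist_lt: eps_cvg => /(_ e e0); apply: filterS => i.
by rewrite sub0r normrN gtr0_norm// => /ltW /le_ball; exact.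
Qed.

Lemma closure_grass_seq k m (S : set (grass K k m)) (L : grass K k m)
    (A : 'M[K]_(k, m)) : row_span A = gr_space L -> closure S L ->
  exists2 B : nat -> 'M[K]_(k, m), B @ \oo --> A &
    forall i, exists2 M, S M & gr_space M = row_span (B i).
Proof.
move=> AL SL.
suff /choice[B BP] : forall i, exists B : 'M[K]_(k, m), ball A (eps i) B /\
    exists2 M, S M & gr_space M = row_span B.
  exists B => [|i]; last by have [] := BP i.
  by apply: cvg_ball_eps => i; have [] := BP i.
move=> i; have : nbhs A (ball A (eps i)) by exact: nbhsx_ballx.
rewrite nbhsE => -[W [Wo WA] Wball].
have /SL[M [SM [B WB MB]]] := open_nbhs_nbhs
  (conj (open_frame_image Wo) (ex_intro2 _ _ A WA (esym AL))).
by exists B; split; [exact: Wball|exists M].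
Qed.

(** Limits along any proper filter give tangent vectors: for each [i] pick an
    index at which all three limits are attained up to [eps i]. *)
Lemma rel_tangent_cone0_cvg n (X Y : set 'rV[K]_n) (T : Type)
    (F : set_system T) (x y : T -> 'rV[K]_n) (l : T -> K) (v : 'rV[K]_n) :
  ProperFilter F ->
  (\forall t \near F, X (x t)) -> (\forall t \near F, Y (y t)) ->
  x @ F --> (0 : 'rV[K]_n) -> y @ F --> (0 : 'rV[K]_n) ->
  (fun t => l t *: (y t - x t)) @ F --> v ->
  rel_tangent_cone0 X Y v.
Proof.
move=> FF Xx Yy x0 y0 lv.
suff /choice[f fP] : forall i, exists t, [/\ X (x t), Y (y t),
    ball 0 (eps i) (x t), ball 0 (eps i) (y t) &
    ball v (eps i) (l t *: (y t - x t))].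
  exists (x \o f), (y \o f), (l \o f).
  split=> [i|i|||]; try (apply: (@cvg_ball_eps 'rV[K]_n) => i).
  - by have [] := fP i.
  - by have [] := fP i.
  - by have [] := fP i.
  - by have [] := fP i.
  - by have [] := fP i.
move=> i; have near_ball (z : T -> 'rV[K]_n) (a : 'rV[K]_n) :
    z @ F --> a  -> \forall t \near F, ball a (eps i) (z t).
  by move=> /cvg_ballP; apply; exact: eps_gt0.
have [t [[? ?] [? [? ?]]]] := filter_ex (filterI (filterI Xx Yy)
  (filterI (near_ball _ _ x0) (filterI (near_ball _ _ y0) (near_ball _ _ lv)))).
by exists t.
Qed.

End Sequences.

(** * Algebraic sets are closed *)

Section Algebraic.
Variable K : numFieldType.

Lemma cvg_meval n (p : mpoly.mpoly n K) (T : Type) (F : set_system T)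
    (v : T -> 'rV[K]_n) (w : 'rV[K]_n) : Filter F -> v @ F --> w ->
  (fun t => mpoly.meval (fun i => v t 0 i) p) @ F
    --> mpoly.meval (fun i => w 0 i) p.
Proof.
move=> FF /cvg_mxP vw; rewrite mpoly.mevalE.
under eq_fun do rewrite mpoly.mevalE.
apply: cvg_sumr => mon _; apply: cvgM; first exact: cvg_cst.
apply: cvg_prodr => i _; elim: (mpoly.fun_of_multinom mon i) => [|d IHd].
  by under eq_fun do rewrite expr0; exact: cvg_cst.
by rewrite exprS; under eq_fun do rewrite exprS; exact: cvgM.
Qed.

Variables (eps : nat -> K) (n : nat).
Hypotheses (eps_gt0 : forall i, 0 < eps i) (eps_cvg : eps @ \oo --> (0 : K)).

(** A vector [c *m u] of the limit point is the limit of the vectors [c *m B i]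
    of the approximating points, and polynomials are continuous. *)
Lemma algebraic_set_closed (X : set (proj_space K n)) :
  algebraic_set X -> closed X.
Proof.
move=> [S [_ ->]] P clP p v Sp vP.
have [u uP] := row_span_surj (gr_dim P).
have [B Bu BX] := closure_grass_seq eps_gt0 eps_cvg uP clP.
move: vP; rewrite -uP => /memv_row_span[c ->].
have cB : (fun i => c *m B i) @ \oo --> c *m u.
  by apply: cvg_mulmx => //; exact: cvg_cst.
apply: (@closed_cvg _ _ \oo _ (fun i => mpoly.meval (fun j => (c *m B i) 0 j) p)
  (fun x => x = 0)) (cvg_meval _ cB).
  by apply: accessible_closed_set1; exact: hausdorff_accessible.
apply: nearW => i; have [M XM MB] := BX i; apply: XM => //.
by rewrite MB; apply/memv_row_span; exists c.
Qed.

End Algebraic.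

(** * Compactness of projective space *)

Section Compactness.
Variable K : numFieldType.
Hypothesis ball_compact : compact [set z : K | `|z| <= 1].
Variables (T : Type) (G : set_system T).
Hypothesis GU : UltraFilter G.

Lemma ultra_fmap (U : Type) (f : T -> U) : UltraFilter (f @ G).
Proof.
split=> [|H HF sub]; first exact: fmap_proper_filter.
apply/seteqP; split=> // A HA.
have [//|GnA] := in_ultra_setVsetC (f @^-1` A) GU.
have /sub HnA : (f @ G) (~` A) by rewrite /= preimage_setC.
by have [? []] := filter_ex (filterI HA HnA).
Qed.

Lemma ultra_cvg_ball m (d : T -> 'rV[K]_m) :
  (forall t, `|d t| <= 1) -> exists v : 'rV[K]_m, d @ G --> v.
Proof.
move=> d1.
have := @rV_compact K m (fun=> [set z : K | `|z| <= 1]) (fun=> ball_compact).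
rewrite compact_ultra => /(_ (d @ G) (ultra_fmap d)) [].
  have coord_le1 t i : `|d t ord0 i| <= 1.
    apply: le_trans (d1 t); rewrite [leRHS]/Num.norm /= mx_normE.
    by rewrite -[leLHS]nngE num_le; exact: (le_bigmax _ _ (ord0, i)).
  exact: (@filterE _ G _ (fun t => forall i, `|d t ord0 i| <= 1)).
by move=> v [_ dv]; exists v.
Qed.

Lemma ultra_cvg_sphere m (d : T -> 'rV[K]_m) :
  (forall t, `|d t| <= 1) -> (\forall t \near G, `|d t| = 1) ->
  exists2 v : 'rV[K]_m, d @ G --> v & v != 0.
Proof.
move=> d1 nd1; have [v dv] := ultra_cvg_ball d1; exists v => //.
have nv1 : `|v| = 1 by apply: (near_cst_cvg _ nd1); exact: cvg_norm.
by rewrite -normr_eq0 nv1 oner_neq0.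
Qed.

(** Projective space is compact: unit representatives converge along the
    ultrafilter, and their limit has norm 1, so it spans a point. *)
Lemma ultra_cvg_point n (P : T -> proj_space K n) :
  exists u : T -> 'rV[K]_n.+1, exists u0 : 'rV[K]_n.+1,
    [/\ forall t, gr_space (P t) = <[u t]>%VS, u0 != 0 & u @ G --> u0].
Proof.
pose u t := `|vpick (gr_space (P t))|^-1 *: vpick (gr_space (P t)).
have nz t : vpick (gr_space (P t)) != 0.
  by rewrite vpick0 -dimv_eq0 (eqP (gr_dim _)).
have u1 t : `|u t| = 1 by rewrite normrZ normfV normr_id mulVf// normr_eq0.
have [||u0 uu0 u0nz] := @ultra_cvg_sphere _ u.
- by move=> t; rewrite u1.
- by apply: nearW => t; exact: u1.
exists u, u0; split=> // t; apply/eqP; rewrite eq_sym eqEdim (eqP (gr_dim _)).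
rewrite dim_vline -normr_eq0 u1 oner_neq0 andbT.
by rewrite -memvE memvZ// memv_pick.
Qed.

End Compactness.

(** * Points, lines and charts *)

Section Projective.
Variables (K : numFieldType) (n : nat).
Implicit Types (P Q M : proj_space K n) (L : proj_lines K n) (i : 'I_n.+1).

Lemma dim_point_add P Q : P <> Q -> \dim (gr_space P + gr_space Q) == 2.
Proof.
move=> PQ; rewrite eqn_leq; apply/andP; split.
  by rewrite (leq_trans (dimv_add_leqif _ _).1)// (eqP (gr_dim P)) (eqP (gr_dim Q)).
rewrite ltnNge; apply/negP => dim1; apply: PQ; apply: val_inj => /=.
have PE : gr_space P = (gr_space P + gr_space Q)%VS.
  by apply/eqP; rewrite eqEdim addvSl (eqP (gr_dim P)).
by apply/eqP; rewrite eq_sym eqEdim {1}PE addvSr (eqP (gr_dim P)) (eqP (gr_dim Q)).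
Qed.

Lemma line_throughE P Q L : P <> Q -> points_of L P -> points_of L Q ->
  gr_space L = (gr_space P + gr_space Q)%VS.
Proof.
move=> PQ PL QL; apply/eqP; rewrite eq_sym eqEdim (eqP (gr_dim L)).
by rewrite (eqP (dim_point_add PQ)) andbT subv_add; apply/andP.
Qed.

Lemma point_span (u : 'rV[K]_n.+1) : u != 0 ->
  exists P, gr_space P = <[u]>%VS.
Proof.
move=> u0; have du : \dim <[u]> == 1%N by rewrite dim_vline u0.
by exists (Grass du).
Qed.

Lemma vline_scale c (w : 'rV[K]_n.+1) : c != 0 -> <[c *: w]>%VS = <[w]>%VS.
Proof.
move=> c0; apply/eqP; rewrite eqEsubv -!memvE memvZ ?memv_line//=.
by apply/vlineP; exists c^-1; rewrite scalerA mulVf// scale1r.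
Qed.

Lemma affine_part_vline i P (w : 'rV[K]_n.+1) : gr_space P = <[w]>%VS ->
  affine_part i P <-> w 0 i != 0.
Proof.
move=> Pw; split=> [Pi|wi /(_ w)].
  apply/eqP => wi; apply: Pi => v; rewrite Pw => /vlineP[c ->].
  by rewrite mxE wi mulr0.
by rewrite Pw memv_line => /(_ isT) /eqP; exact/negP.
Qed.

Lemma affine_map_vline i P (w : 'rV[K]_n.+1) : gr_space P = <[w]>%VS ->
  affine_map i P = (w 0 i)^-1 *: col' i w.
Proof.
move=> Pw; have := memv_pick (gr_space P).
have : vpick (gr_space P) != 0 by rewrite vpick0 -dimv_eq0 (eqP (gr_dim _)).
rewrite /affine_map; move: (vpick _) => v; rewrite Pw => v0 /vlineP[c vE].
have c0 : c != 0 by apply: contraNneq v0 => c0; rewrite vE c0 scale0r.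
apply/rowP => j; rewrite !mxE vE !mxE.
by rewrite invfM mulrACA mulfV// mul1r mulrC.
Qed.

(** The inverse of the [i]-th chart, as a vector with [i]-th coordinate 1: the
    matrix [row' i 1%:M] inserts a zero in position [i]. *)
Definition chart_inv (i : 'I_n.+1) (x : 'rV[K]_n) : 'rV[K]_n.+1 :=
  delta_mx 0 i + x *m row' i 1%:M.

Lemma insert_coord_eq0 i (x : 'rV[K]_n) : (x *m row' i 1%:M) 0 i = 0.
Proof.
rewrite mxE big1// => j _; rewrite !mxE.
by rewrite eq_sym (negbTE (neq_lift i j)) mulr0.
Qed.

Lemma insert_col'K i (v : 'rV[K]_n.+1) :
  v 0 i = 0 -> col' i v *m row' i 1%:M = v.
Proof.
move=> vi; apply/rowP => k; case: (unliftP i k) => [j ->|->]; last first.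
  by rewrite insert_coord_eq0.
rewrite mxE (bigD1 j)//= big1 => [|j' jj']; rewrite !mxE.
  by rewrite eqxx mulr1 addr0.
by rewrite (inj_eq (@lift_inj _ i)) (negbTE jj') mulr0.
Qed.

Lemma chart_inv_col' i (v : 'rV[K]_n.+1) :
  v 0 i = 1 -> chart_inv i (col' i v) = v.
Proof.
move=> vi; rewrite -[RHS](subrK (delta_mx 0 i)) addrC /chart_inv.
congr (_ + _); rewrite -[RHS](@insert_col'K i); last first.
  by rewrite !mxE vi !eqxx subrr.
congr (_ *m _); rewrite linearB /=; apply/rowP => j; rewrite !mxE.
by rewrite [lift i j == i]eq_sym (negbTE (neq_lift i j)) andbF subr0.
Qed.

Lemma chart_inv_coord i (x : 'rV[K]_n) : chart_inv i x 0 i = 1.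
Proof. by rewrite mxE insert_coord_eq0 mxE !eqxx addr0. Qed.

Lemma chart_inv_neq0 i (x : 'rV[K]_n) : chart_inv i x != 0.
Proof.
by apply: contra_neq (oner_neq0 K) => x0; rewrite -(chart_inv_coord i x) x0 mxE.
Qed.

Lemma chart_inv_affine_map i P : affine_part i P ->
  gr_space P = <[chart_inv i (affine_map i P)]>%VS.
Proof.
move=> Pi; have [w wP] := row_span_surj (gr_dim P).
have {}wP := etrans (esym wP) (row_span1 w).
have wi := proj1 (affine_part_vline i wP) Pi.
rewrite (affine_map_vline i wP) -linearZ chart_inv_col'; last by rewrite mxE mulVf.
by rewrite vline_scale// invr_neq0.
Qed.

Lemma chart_invD i (x y : 'rV[K]_n) :
  chart_inv i (x + y) = chart_inv i x + y *m row' i 1%:M.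
Proof. by rewrite /chart_inv mulmxDl addrA. Qed.

Lemma cvg_chart_inv (T : Type) (F : set_system T) i (x : T -> 'rV[K]_n)
    (a : 'rV[K]_n) : Filter F -> x @ F --> a ->
  (fun t => chart_inv i (x t)) @ F --> chart_inv i a.
Proof.
move=> FF xa; apply: cvgD; first exact: cvg_cst.
by apply: cvg_mulmx => //; exact: cvg_cst.
Qed.

End Projective.

(** * Limits of secants are tangent *)

Section Joins.
Variables (K : numFieldType) (n : nat) (eps : nat -> K).
Hypotheses (eps_gt0 : forall i, 0 < eps i) (eps_cvg : eps @ \oo --> (0 : K)).
Implicit Types (X Y : set (proj_space K n)) (P Q M : proj_space K n).
Implicit Types (L : proj_lines K n) (i : 'I_n.+1).

(** If secants of [X] and [Y] shrink to [P] with limit direction [v], the line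
    through [p] and [v] lies in the tangent cone.  Its affine points are
    [p + (d / c) v], reached by multiplying every [l t] by [d / c]; its point at
    infinity, spanned by [b v], is the limit of [eps k p + b v]. *)
Lemma secant_limit_cone X Y P i (T : Type) (F : set_system T)
    (x y : T -> 'rV[K]_n.+1) (l : T -> K) (p v : 'rV[K]_n.+1) (a b : K) M :
  ProperFilter F -> p 0 i = 1 -> v 0 i = 0 -> v != 0 ->
  (\forall t \near F,
    x t 0 i = 1 /\ exists2 Q, X Q & gr_space Q = <[x t]>%VS) ->
  (\forall t \near F,
    y t 0 i = 1 /\ exists2 Q, Y Q & gr_space Q = <[y t]>%VS) ->
  x @ F --> p -> y @ F --> p -> (fun t => l t *: (y t - x t)) @ F --> v ->
  gr_space P = <[p]>%VS -> gr_space M = <[a *: p + b *: v]>%VS ->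
  proj_rel_tangent_cone i P X Y M.
Proof.
move=> FF pi1 vi v0 Xx Yy xp yp lv PE.
pose C : set (proj_space K n) := affine_part i `&` affine_map i @^-1`
    rel_tangent_cone (affine_map i P) (affine_map i @` (X `&` affine_part i))
                                      (affine_map i @` (Y `&` affine_part i)).
have coord c d : (c *: p + d *: v) 0 i = c by rewrite !mxE pi1 vi mulr1 mulr0 addr0.
have affine c d N : c != 0 -> gr_space N = <[c *: p + d *: v]>%VS -> C N.
  move=> c0 NE; split; first by apply/(affine_part_vline i NE); rewrite coord.
  rewrite /= (affine_map_vline i NE) coord linearD !linearZ /= scalerDr !scalerA.
  rewrite mulVf// (affine_map_vline i PE) pi1 invr1 !scale1r.
  exists ((c^-1 * d) *: col' i v) => //.
  have image (Z : set (proj_space K n)) (z : T -> 'rV[K]_n.+1) :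
      (\forall t \near F,
        z t 0 i = 1 /\ exists2 Q, Z Q & gr_space Q = <[z t]>%VS) ->
      \forall t \near F,
        [set z' - col' i p | z' in affine_map i @` (Z `&` affine_part i)]
        (col' i (z t) - col' i p).
    apply: filterS => t [zt1 [Q ZQ QE]]; exists (col' i (z t)) => //.
    exists Q; first by split=> //; apply/(affine_part_vline i QE); rewrite zt1 oner_neq0.
    by rewrite (affine_map_vline i QE) zt1 invr1 scale1r.
  have shift (z : T -> 'rV[K]_n.+1) : z @ F --> p ->
      (fun t => col' i (z t) - col' i p) @ F --> (0 : 'rV[K]_n).
    move=> zp; rewrite -(subrr (col' i p)).
    by apply: cvgB; [exact: cvg_col'|exact: cvg_cst].
  apply: (rel_tangent_cone0_cvg eps_gt0 eps_cvg FF (image _ _ Xx) (image _ _ Yy)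
    (shift _ xp) (shift _ yp) (l := fun t => c^-1 * d * l t)).
  have -> : (fun t => c^-1 * d * l t *: (col' i (y t) - col' i p
                                         - (col' i (x t) - col' i p)))
          = (fun t => (c^-1 * d) *: col' i (l t *: (y t - x t))).
    apply/funext => t; rewrite opprB addrA subrK.
    rewrite [col' i (_ *: _)]linearZ /= scalerA.
    by congr (_ *: _); rewrite linearB.
  by apply: cvgZ; [exact: cvg_cst|exact: cvg_col'].
(* When a = 0 the point is at infinity, and only the closure contains it. *)
have [->|a0] := eqVneq a 0; last first.
  by move=> ME; apply: subset_closure; exact: affine ME.
rewrite scale0r add0r => ME.
apply: (closure_grass_cvg (F := \oo) (B := fun k => eps k *: p + b *: v)
  (A := b *: v)); first by rewrite row_span1 ME.
  rewrite -[X in _ --> X]add0r -(scale0r p).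
  by apply: cvgD; [apply: cvgZ; [exact: eps_cvg|exact: cvg_cst]|exact: cvg_cst].
apply: nearW => k.
have ek : eps k != 0 by rewrite gt_eqF.  
have [N NE] : exists N : proj_space K n, gr_space N = <[eps k *: p + b *: v]>%VS.
  apply: point_span; apply: contra_neq ek => e0.
  by rewrite -(coord (eps k) b) e0 mxE.
by exists N; [exact: affine NE|rewrite row_span1].
Qed.

Lemma point_closed_limit X (T : Type) (F : set_system T) (u : T -> 'rV[K]_n.+1)
    (u0 : 'rV[K]_n.+1) P : ProperFilter F -> closed X -> u @ F --> u0 ->
  (forall t, exists2 M, X M & gr_space M = <[u t]>%VS) ->
  gr_space P = <[u0]>%VS -> X P.
Proof.
move=> FF Xc uu0 Xu PE; apply: Xc.
apply: (closure_grass_cvg (F := F) (B := u) (A := u0)) => //.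
  by rewrite row_span1 PE.
by apply: nearW => t; have [M XM ME] := Xu t; exists M => //; rewrite row_span1.
Qed.

Hypothesis ball_compact : compact [set z : K | `|z| <= 1].

(** A limit of secants either joins the limits of the two moving points, or,
    if these limits coincide, is tangent there. *)
Lemma joining_lines_sub X Y L : closed X -> closed Y -> joining_lines X Y L ->
  joining_lines0 X Y L \/
  exists P, [/\ X P, Y P & forall i, affine_part i P -> tangent_lines i P X Y L].
Proof.
move=> Xc Yc JL.
have [A AL] := row_span_surj (gr_dim L).
have Afree : row_free A by rewrite -row_free_dim_row_span AL; exact: gr_dim.
have [B BA BJ] := closure_grass_seq eps_gt0 eps_cvg AL JL.
have /choice[P PP] : forall k, exists P, exists Q, [/\ X P, Y Q, P <> Q &
    row_span (B k) = (gr_space P + gr_space Q)%VS].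
  by move=> k; have [M [P [Q [XP YQ PQ ME]]] <-] := BJ k; exists P, Q.
have /choice[Q PQ] := PP.
have [G [GU ooG]] := ultraFilterLemma (F := \oo) _.
have {}BA : B @ G --> A by move=> U /BA /ooG.
have [u [u0 [uE u0nz uu0]]] := ultra_cvg_point ball_compact GU P.
have [w [w0 [wE w0nz ww0]]] := ultra_cvg_point ball_compact GU Q.
have uB k : u k \in row_span (B k).
  have [_ _ _ ->] := PQ k.
  by rewrite memvE (subv_trans _ (addvSl _ _))// uE -memvE memv_line.
have wB k : w k \in row_span (B k).
  have [_ _ _ ->] := PQ k.
  by rewrite memvE (subv_trans _ (addvSr _ _))// wE -memvE memv_line.
have [P0 P0E] := point_span u0nz; have [Q0 Q0E] := point_span w0nz.
have XP0 : X P0.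
  apply: (point_closed_limit _ Xc uu0 _ P0E) => k.
  by exists (P k); [have [] := PQ k|exact: uE].
have YQ0 : Y Q0.
  apply: (point_closed_limit _ Yc ww0 _ Q0E) => k.
  by exists (Q k); [have [] := PQ k|exact: wE].
have P0L : points_of L P0.
  rewrite /points_of /= P0E -AL -memvE.
  by apply: (row_span_cvg _ Afree BA _ uu0); exact: nearW.
have Q0L : points_of L Q0.
  rewrite /points_of /= Q0E -AL -memvE.
  by apply: (row_span_cvg _ Afree BA _ ww0); exact: nearW.
have [PQ0|] := pselect (P0 = Q0); last first.
  by move=> PQ0; left; exists P0, Q0; split=> //; exact: line_throughE.
right; exists P0; split=> // [|i P0i]; first by rewrite PQ0.
split=> //.
have u0i := proj1 (affine_part_vline i P0E) P0i.
have w0i : w0 0 i != 0 by apply/(affine_part_vline i Q0E); rewrite -PQ0.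
pose x k := (u k 0 i)^-1 *: u k; pose y k := (w k 0 i)^-1 *: w k.
pose p := (u0 0 i)^-1 *: u0.
have pi1 : p 0 i = 1 by rewrite mxE mulVf.
have PpE : gr_space P0 = <[p]>%VS by rewrite vline_scale// invr_neq0.
have QpE : (w0 0 i)^-1 *: w0 = p.
  have : (w0 0 i)^-1 *: w0 \in <[p]>%VS.
    by rewrite -PpE PQ0 Q0E memvZ ?memv_line.
  move=> /vlineP[c cE]; rewrite cE; suff -> : c = 1 by rewrite scale1r.
  by move/rowP/(_ i): cE; rewrite !mxE mulVf// mulVf// mulr1.
have cvg_coord (z : nat -> 'rV[K]_n.+1) (z0 : 'rV[K]_n.+1) :
  z @ G --> z0 -> (fun k => z k 0 i) @ G --> z0 0 i by move=> /cvg_mxP; apply.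
have xp : x @ G --> p by apply: cvgZ => //; apply: cvgV => //; exact: cvg_coord.
have yp : y @ G --> p.
  by rewrite -QpE; apply: cvgZ => //; apply: cvgV => //; exact: cvg_coord.
have ui : \forall k \near G, u k 0 i != 0 by apply: cvgr_neq0 (cvg_coord _ _ uu0) u0i.
have wi : \forall k \near G, w k 0 i != 0 by apply: cvgr_neq0 (cvg_coord _ _ ww0) w0i.
(* The normalised secant directions; where y k = x k, d k is 0. *)
pose l k := `|y k - x k|^-1; pose d k := l k *: (y k - x k).
have d1 k : `|d k| <= 1.
  rewrite normrZ normfV normr_id; have [->|yx] := eqVneq `|y k - x k| 0.
    by rewrite mulr0.
  by rewrite mulVf.
have xyG : \forall k \near G, [/\ x k 0 i = 1, y k 0 i = 1,
    gr_space (P k) = <[x k]>%VS & gr_space (Q k) = <[y k]>%VS].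
  apply: filterS (filterI ui wi) => k [uki wki].
  by rewrite uE wE !vline_scale ?invr_neq0//; split; rewrite // mxE mulVf.
have nd1 : \forall k \near G, `|d k| = 1.
  apply: filterS xyG => k [_ _ PE QE].
  rewrite normrZ normfV normr_id mulVf// normr_eq0 subr_eq0.
  have [_ _ PQk _] := PQ k; apply/eqP => xy.
  by apply: PQk; apply: val_inj; rewrite /= PE QE xy.
have [v dv v0] := ultra_cvg_sphere ball_compact GU d1 nd1.
have vi : v 0 i = 0.
  apply: (near_cst_cvg (F := G) _ _ (cvg_coord _ _ dv)).
  apply: filterS xyG => k [xi yi _ _].
  by rewrite 2!mxE [X in _ + X]mxE xi yi subrr mulr0.
have vL : v \in row_span A.
  apply: (row_span_cvg _ Afree BA _ dv); apply: nearW => k.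
  by rewrite memvZ// memvB// memvZ.
have pL : p \in row_span A by rewrite memvZ// AL memvE -P0E.
(* p and v are independent because their i-th coordinates are 1 and 0. *)
have LE : gr_space L = (<[p]> + <[v]>)%VS.
  have [V VE] := point_span v0.
  rewrite -PpE -VE; apply: line_throughE => //.
    move=> PV; have : p \in gr_space V by rewrite -PV PpE memv_line.
    rewrite VE => /vlineP[c /rowP/(_ i)]; rewrite pi1 mxE vi mulr0 => /eqP.
    by rewrite oner_eq0.
  by rewrite /points_of /= VE -memvE -AL.
move=> M ML.
have [m mM] := row_span_surj (gr_dim M).
have {}mM := etrans (esym mM) (row_span1 m).
have : m \in gr_space L by rewrite memvE -mM.
rewrite LE => /memv_addP[_ /vlineP[a ->] [_ /vlineP[b ->] mE]].
rewrite mE in mM.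
apply: (secant_limit_cone _ pi1 vi v0 _ _ xp yp dv PpE mM).
  apply: filterS xyG => k [-> _ PE _]; split=> //.
  by exists (P k) => //; have [] := PQ k.
apply: filterS xyG => k [_ -> _ QE]; split=> //.
by exists (Q k) => //; have [] := PQ k.
Qed.

End Joins.

(** * Tangent lines are limits of secants *)

Section TangentLines.
Variables (K : numFieldType) (n : nat) (eps : nat -> K).
Hypotheses (eps_gt0 : forall i, 0 < eps i) (eps_cvg : eps @ \oo --> (0 : K)).
Implicit Types (X Y : set (proj_space K n)) (P Q M : proj_space K n).
Implicit Types (L : proj_lines K n) (i : 'I_n.+1).

(** The secant through [x k] and [y k] is spanned by [x k] and
    [x k + l k (y k - x k)] as soon as these are independent; that pair tends to
    the pair of representatives of [P] and [M], which is independent. *)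
Lemma affine_cone_line X Y P M L i :
  affine_part i P -> affine_part i M ->
  rel_tangent_cone (affine_map i P) (affine_map i @` (X `&` affine_part i))
    (affine_map i @` (Y `&` affine_part i)) (affine_map i M) ->
  gr_space L = (gr_space P + gr_space M)%VS -> joining_lines X Y L.
Proof.
move=> Pi Mi [v [x [y [l [xX yY x0 y0 lv]]]] vE] LE.
set p := affine_map i P in x0 y0 xX yY vE.
pose B k : 'M[K]_(1 + 1, n.+1) := col_mx (chart_inv i (p + x k))
  (chart_inv i (p + x k + l k *: (y k - x k))).
pose A : 'M[K]_(1 + 1, n.+1) := col_mx (chart_inv i p) (chart_inv i (p + v)).
have AL : row_span A = gr_space L.
  rewrite row_span2 LE (chart_inv_affine_map Pi) (chart_inv_affine_map Mi).
  by rewrite -vE.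
have Afree : row_free A by rewrite -row_free_dim_row_span AL; exact: gr_dim.
have px : (fun k => p + x k) @ \oo --> p.
  by rewrite -[X in _ --> X]addr0; apply: cvgD => //; exact: cvg_cst.
have BA : B @ \oo --> A.
  by apply: cvg_col_mx; apply: cvg_chart_inv => //; exact: cvgD.
apply: (closure_grass_cvg (F := \oo) _ AL BA).
apply: filterS (near_row_free _ Afree BA) => k Bfree.
rewrite -row_free_dim_row_span in Bfree.
exists (Grass Bfree) => //.
have [P' [XP P'i] P'E] : exists2 P', (X `&` affine_part i) P' &
    affine_map i P' = p + x k.
  by have [_ [P' P'X <-] <-] := xX k; exists P'; rewrite // addrC subrK.
have [Q' [YQ Q'i] Q'E] : exists2 Q', (Y `&` affine_part i) Q' &
    affine_map i Q' = p + y k.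
  by have [_ [Q' Q'Y <-] <-] := yY k; exists Q'; rewrite // addrC subrK.
have BPQ : (row_span (B k) <= gr_space P' + gr_space Q')%VS.
  rewrite row_span2 (chart_inv_affine_map P'i) (chart_inv_affine_map Q'i).
  rewrite P'E Q'E subv_add addvSl /= chart_invD -memvE.
  have -> : y k - x k = (p + y k) - (p + x k) by rewrite opprD addrACA subrr add0r.
  have -> (a b : 'rV[K]_n) c : (c *: (a - b)) *m row' i 1%:M
      = c *: (chart_inv i a - chart_inv i b).
    by rewrite /chart_inv opprD addrACA subrr add0r -mulmxBl scalemxAl.
  apply: memvD; first exact: (subvP (addvSl _ _) _ (memv_line _)).
  apply: memvZ; apply: memvB; first exact: (subvP (addvSr _ _) _ (memv_line _)).
  exact: (subvP (addvSl _ _) _ (memv_line _)).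
have PQ : P' <> Q'.
  move=> PQ; have := dimvS BPQ; rewrite -PQ addvv (eqP (gr_dim P')).
  by rewrite (eqP Bfree).
exists P', Q'; split=> //=; apply/eqP.
by rewrite eqEdim BPQ (eqP Bfree) (eqP (dim_point_add PQ)).
Qed.

(** A point [Q] of the closed cone is a limit of points [M] of the affine cone,
    so the line [PQ] is a limit of lines [PM], each a limit of secants. *)
Lemma cone_line X Y P Q L i :
  affine_part i P -> P <> Q -> proj_rel_tangent_cone i P X Y Q ->
  gr_space L = (gr_space P + gr_space Q)%VS -> joining_lines X Y L.
Proof.
move=> Pi PQ CQ LE; rewrite /joining_lines.
rewrite (proj1 (closure_id _) (@closed_closure _ _)).
have [q qQ] := row_span_surj (gr_dim Q).
have [p pP] := row_span_surj (gr_dim P).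
have [s sq sC] := closure_grass_seq eps_gt0 eps_cvg qQ CQ.
have AL : row_span (col_mx p q : 'M[K]_(1 + 1, _)) = gr_space L.
  by rewrite row_span2 -!row_span1 pP qQ LE.
have Afree : row_free (col_mx p q : 'M[K]_(1 + 1, _)).
  by rewrite -row_free_dim_row_span AL; exact: gr_dim.
have BA : (fun k => col_mx p (s k) : 'M[K]_(1 + 1, _)) @ \oo --> col_mx p q.
  by apply: cvg_col_mx => //; exact: cvg_cst.
apply: (closure_grass_cvg (F := \oo) _ AL BA).
apply: filterS (near_row_free _ Afree BA) => k.
rewrite -row_free_dim_row_span => Bfree.
exists (Grass Bfree) => //; have [M [Mi MC] ME] := sC k.
by apply: (affine_cone_line Pi Mi MC); rewrite /= row_span2 -!row_span1 pP ME.
Qed.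

End TangentLines.

(** * The complex numbers *)

(** The topology on [R[i]] is inherited from its [numFieldType] structure, so it
    is only found on the sort of that structure. *)
Definition complex_field (R : realType) : numFieldType := R[i].

Section Complex.
Variable R : realType.
Local Notation C := (complex_field R).

Let normC_le (a b : R) : `|(a +i* b)%C| <= (`|a| + `|b|)%:C%C.
Proof.
rewrite normc_def lecR /= -[leRHS]ger0_norm ?addr_ge0// -sqrtr_sqr ler_wsqrtr//.
rewrite sqrrD !real_normK ?num_real// -addrA lerD2l lerDr.
by rewrite mulrn_wge0// mulr_ge0.
Qed.

Let gt0_complexE (e : R[i]) : 0 < e -> exists2 r : R, 0 < r & e = r%:C%C.
Proof.
case: e => a b; rewrite ltcE /= => /andP[/eqP b0 a0].
by exists a; rewrite // b0.
Qed.

(** The unit disc is closed, and contained in a continuous image of the compact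
    real square of side [-1, 1]. *)
Lemma complex_ball_compact : compact [set z : C | `|z| <= 1].
Proof.
pose f (ab : R * R) : C := (ab.1 +i* ab.2)%C.
have fc : continuous f.
  move=> ab; apply/cvgrPdist_lt => e e0.
  have [r r0 eE] := gt0_complexE e0.
  have e2 : 0 < r / 2 by rewrite divr_gt0.
  have c1 : \forall z \near ab, `|ab.1 - z.1| < r / 2.
    by apply: (proj1 (cvgrPdist_lt _ _) cvg_fst).
  have c2 : \forall z \near ab, `|ab.2 - z.2| < r / 2.
    by apply: (proj1 (cvgrPdist_lt _ _) cvg_snd).
  apply: filterS (filterI c1 c2) => z [z1 z2].
  apply: le_lt_trans (normC_le (ab.1 - z.1) (ab.2 - z.2)) _.
  by rewrite eE ltcR [r]splitr ltrD.
have closed_ball1 : closed [set z : C | `|z| <= 1].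
  move=> z zcl; apply/ler_addgt0Pr => e e0.
  have [y [y1 zy]] := zcl _ (nbhsx_ballx z e e0).
  have -> : z = y + (z - y) by rewrite addrC subrK.
  apply: le_trans (ler_normD _ _) _; apply: lerD => //.
  exact: ltW.
have I : compact (`[(-1), 1]%classic `*` `[(-1), 1]%classic : set (R * R)).
  by apply: compact_setX; exact: segment_compact.
apply: (subclosed_compact closed_ball1 (continuous_compact _ I)).
  exact: continuous_subspaceT fc.
move=> [a b] /= ab1; exists (a, b) => //=.
move: ab1; rewrite normc_def -[1]/(1%:C%C) lecR /= => ab1.
have {}ab1 : a ^+ 2 + b ^+ 2 <= 1.
  by rewrite -(@ler_sqrt _ _ 1)// sqrtr1.
rewrite !in_itv /= -!ler_norml.
by split; rewrite -(@expr_le1 _ 2)// real_normK ?num_real//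
  (le_trans _ ab1)// ?lerDl ?lerDr sqr_ge0.
Qed.

Lemma harmonic_cvg_complex :
  (fun k => (k.+1%:R)^-1 : C) @ \oo --> (0 : C).
Proof.
apply/cvgrPdist_lt => e e0.
have [r r0 ->] := gt0_complexE e0.
apply: filterS (near_infty_natSinv_lt (PosNum r0)) => k kr.
rewrite sub0r normrN ger0_norm ?invr_ge0//.
by rewrite -(rmorph_nat (real_complex R)) -fmorphV ltcR.
Qed.


End Complex.

(** * Joins and relative tangent cones *)

Theorem proposition4p1 (R : realType) (n : nat)
    (X Y : set (proj_space R[i] n))
    (hX : algebraic_set X) (hY : algebraic_set Y)
    (chart : proj_space R[i] n -> 'I_n.+1)
    (hchart : forall P, affine_part (chart P) P) :
  joining_lines X Y =
    joining_lines0 X Y `|`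
      \bigcup_(P in X `&` Y) tangent_lines (chart P) P X Y
  /\ (~ (exists P, X = [set P] /\ Y = [set P]) ->
  join X Y =
    join0 X Y `|`
      \bigcup_(P in X `&` Y) proj_rel_tangent_cone (chart P) P X Y).
Proof.
pose eps k : complex_field R := (k.+1%:R)^-1.
have eps_gt0 k : 0 < eps k by rewrite invr_gt0 ltr0n.
have eps0 : eps @ \oo --> (0 : complex_field R) by exact: harmonic_cvg_complex.
have Xc := algebraic_set_closed eps_gt0 eps0 hX.
have Yc := algebraic_set_closed eps_gt0 eps0 hY.
have lines : joining_lines X Y = joining_lines0 X Y `|`
    \bigcup_(P in X `&` Y) tangent_lines (chart P) P X Y.
  apply/seteqP; split=> L.
    move=> /(joining_lines_sub eps_gt0 eps0 (@complex_ball_compact R) Xc Yc).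
    move=> [|[P [XP YP PL]]]; [by left|right].
    by exists P; [split|apply: PL; exact: hchart].
  move=> [|[P _ [LC PL]]]; first exact: subset_closure.
  have [Q QL PQ] : exists2 Q, points_of L Q & P <> Q.
    have : ~~ (gr_space L <= gr_space P)%VS.
      by apply/negP => /dimvS; rewrite (eqP (gr_dim L)) (eqP (gr_dim P)).
    move=> /subvPn[q qL qP].
    have [|Q QE] := @point_span _ _ q; first by apply: contraNneq qP => ->; exact: mem0v.
    exists Q; first by rewrite /points_of /= QE -memvE.
    by move=> PQ; rewrite PQ QE memv_line in qP.
  apply: (cone_line eps_gt0 eps0 (hchart P) PQ (LC _ QL)).
  exact: line_throughE.
split=> // nXY; apply/seteqP; split=> Q.
  move=> [L]; rewrite lines => -[JL|[P XYP [LC _]]] QL; first by left; exists L.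
  by right; exists P => //; exact: LC.
move=> [[L JL QL]|[P [XP YP] CQ]]; first by exists L => //; exact: subset_closure.
have [PQ|PQ] := pselect (P = Q); last first.
  exists (Grass (dim_point_add PQ)); last exact: addvSr.
  exact: (cone_line eps_gt0 eps0 (hchart P) PQ CQ).
rewrite -{}PQ {CQ Q}.
have [M [XYM MP]] : exists M, (X M \/ Y M) /\ M <> P.
  apply: contrapT => noM; apply: nXY; exists P.
  split; apply/seteqP; split=> M; try by move=> ->.
    by move=> XM; apply: contrapT => MP; apply: noM; exists M; split; [left|].
  by move=> YM; apply: contrapT => MP; apply: noM; exists M; split; [right|].
case: XYM => [XM|YM].
  exists (Grass (dim_point_add MP)); last exact: addvSr.
  by apply: subset_closure; exists M, P.
have PM : P <> M by move=> PM; exact: MP.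
exists (Grass (dim_point_add PM)); last exact: addvSl.
by apply: subset_closure; exists P, M.
Qed.
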